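(* Let $M$ be an arbitrary convex set of equivalent measures on $(\Omega,\mathcal F)$, and let $\{f_m,\mathcal F_m\}_{m=0}^\infty$ be a nonnegative uniformly integrable super-martingale relative to $M$ (uniform integrability being understood relative to the measures of $M$). Then $\{f_m,\mathcal F_m\}_{m=0}^\infty$ is local regular if and only if it belongs to the set $K$ (defined in the context).
   Context: Let $(\Omega,\mathcal F)$ be a measurable space with a filtration $\mathcal F_0\subset\mathcal F_1\subset\dots\subset\mathcal F$, where $\mathcal F_0=\{\emptyset,\Omega\}$ and $\mathcal F=\sigma(\bigcup_{n\ge1}\mathcal F_n)$. ''Convex set of equivalent measures'' means a convex set $M$ of pairwise equivalent probability measures on $\mathcal F$. Standing assumption: for all $P,Q\in M$ the density $\frac{dP}{dQ}$ is $\mathcal F_1$-measurable and $P_0\left(\frac{dP}{dQ}>0\right)=1$, where $P_0\in M$ is a fixed measure. Super-martingale relative to $M$: an adapted process $\{f_m\}_{m=0}^\infty$ with $E^P|f_m|<\infty$ for all $m\ge1$, $P\in M$, and $E^P\{f_m|\mathcal F_k\}\le f_k$ for all $0\le k\le m$, $P\in M$. A super-martingale relative to $M$ is local regular if $\sup_{P\in M}E^P|f_m|<\infty$ for all $m\ge1$ and there is an adapted nonnegative increasing (non-decreasing in $m$) process $\{g_m,\mathcal F_m\}_{m=0}^\infty$, $g_0=0$, $\sup_{P\in M}E^P|g_m|<\infty$ for $m\ge1$, such that $\{f_m+g_m,\mathcal F_m\}_{m=0}^\infty$ is a martingale relative to every measure from $M$. $A_0$ is the set of all nonnegative random variables $\xi$,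 integrable relative to $M$, with $E^P\xi=1$ for all $P\in M$. For $\xi\in A_0$ the process $\{E^P\{\xi|\mathcal F_m\}\}_{m\ge0}$ does not depend on the choice of $P\in M$. $F_0$ is the set of adapted processes $\{f_m\}_{m=0}^\infty$ with $P(|f_m|<\infty)=1$ for all $P\in M$ and $f_m\le f_{m-1}$ for $m\ge1$. For $\xi\in A_0$, $$L_\xi=\big\{\{f_mE^P\{\xi|\mathcal F_m\}\}_{m=0}^\infty:\ \{f_m\}_{m=0}^\infty\in F_0,\ E^P\xi|f_m|<\infty,\ P\in M\big\},$$ $V=\bigcup_{\xi\in A_0}L_\xi$, and $$K=\Big\{\sum_{i=1}^mC_i\bar f_i:\ \bar f_i\in V,\ C_i\ge0,\ i=1,\dots,m,\ m=1,2,\dots\Big\}.$$ *)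

(* Defs.v *)
From HB Require Import structures.
From mathcomp Require Import all_boot all_order all_algebra.
From mathcomp Require Import all_classical all_reals all_analysis.
From mathcomp Require Import measurable_realfun.

Set Implicit Arguments.
Unset Strict Implicit.
Unset Printing Implicit Defensive.

Import Order.TTheory GRing.Theory Num.Theory.
Import numFieldNormedType.Exports.

Local Open Scope classical_set_scope.
Local Open Scope ring_scope.
Local Open Scope ereal_scope.
Local Open Scope charge_scope.

(* Random variables take values in [\bar R]; equalities and inequalities
   between random variables are understood almost surely. *)

Section filtration.
Context (d : measure_display) (T : measurableType d).

Definition is_filtration (F : nat -> set (set T)) : Prop :=
  [/\ forall n, sigma_algebra setT (F n),
      forall n, F n `<=` F n.+1,
      forall n, F n `<=` measurable,
      F 0%N = [set set0; setT] &
      @measurable d T = <<s \bigcup_(n in [set n | (1 <= n)%N]) F n >>].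

End filtration.

Section processes.
Context (R : realType) (d : measure_display) (T : measurableType d).
Implicit Types (F : nat -> set (set T)) (G : set (set T)).
Implicit Types (P Q : probability T R) (M : set (probability T R)).
Implicit Types (X Y xi : T -> \bar R) (f g e h : nat -> T -> \bar R).

Definition sub_measurable G X : Prop :=
  measurable_fun [set: g_sigma_algebraType G]
    (X : g_sigma_algebraType G -> \bar R).

Definition adapted F f : Prop := forall m, sub_measurable (F m) (f m).

(* [Y] is a version of the conditional expectation of [X] given [G]. *)
Definition is_condexp P G X Y : Prop :=
  [/\ P.-integrable setT X, P.-integrable setT Y, sub_measurable G Y &
      forall A, G A -> \int[P]_(x in A) Y x = \int[P]_(x in A) X x].

(* A probability is a function on all subsets of [T], unconstrained outside
   the measurable ones, so the mixture is only prescribed on the latter. *)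
Definition convex_measures M : Prop :=
  forall P Q (t : R), M P -> M Q -> (0 <= t <= 1)%R ->
    exists2 S, M S & forall A, measurable A ->
      S A = t%:E * P A + (1 - t)%:E * Q A.

Definition equivalent_measures M : Prop :=
  forall P Q, M P -> M Q -> P `<< Q /\ Q `<< P.

Definition density P Q : T -> \bar R :=
  'd (charge_of_finite_measure P) '/d Q.

(* The density is determined up to a [Q]-null set, and [F 1] need not contain
   the null sets: measurability means having an [F 1]-measurable version. *)
Definition F1_densities F M (P0 : probability T R) : Prop :=
  forall P Q, M P -> M Q ->
    (exists2 Y, sub_measurable (F 1%N) Y & Y = density P Q %[ae Q]) /\
    P0 [set x | 0 < density P Q x] = 1.

Definition martingale F P f : Prop :=
  adapted F f /\
  forall k m, (k <= m)%N -> is_condexp P (F k) (f m) (f k).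

Definition supermartingale F M f : Prop :=
  [/\ adapted F f,
      forall m P, (1 <= m)%N -> M P -> P.-integrable setT (f m) &
      forall k m P, (k <= m)%N -> M P ->
        exists2 Y, is_condexp P (F k) (f m) Y & \forall x \ae P, Y x <= f k x].

Definition nonneg_process M f : Prop :=
  forall m P, M P -> \forall x \ae P, 0 <= f m x.

Definition uniformly_integrable P f : Prop :=
  ereal_sup [set \int[P]_(x in [set x | c%:E < `|f m x|]) `|f m x| | m in setT]
    @[c --> +oo%R] --> (0 : \bar R).

Definition sup_norm1 M X : \bar R :=
  ereal_sup [set \int[P]_x `|X x| | P in M].

Definition local_regular F M f : Prop :=
  [/\ supermartingale F M f,
      forall m, (1 <= m)%N -> sup_norm1 M (f m) < +oo &
      exists g, [/\ adapted F g /\ nonneg_process M g,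
        forall m P, M P -> \forall x \ae P, g m x <= g m.+1 x,
        forall P, M P -> \forall x \ae P, g 0%N x = 0,
        forall m, (1 <= m)%N -> sup_norm1 M (g m) < +oo &
        forall P, M P -> martingale F P (fun m x => f m x + g m x)]].

Definition setA0 M : set (T -> \bar R) :=
  [set xi | forall P, M P ->
    [/\ P.-integrable setT xi, \forall x \ae P, 0 <= xi x &
        \int[P]_x xi x = 1]].

Definition setF0 F M : set (nat -> T -> \bar R) :=
  [set h | [/\ adapted F h,
    forall m P, M P -> \forall x \ae P, `|h m x| < +oo &
    forall m P, M P -> \forall x \ae P, h m.+1 x <= h m x]].

(* The conditional expectations of [xi] may be computed under any one measure
   of [M]: for [xi] in [setA0 M] they do not depend on that choice. *)
Definition setL F M xi : set (nat -> T -> \bar R) :=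
  [set f | exists h e, [/\ setF0 F M h,
    forall m P, M P -> P.-integrable setT (fun x => xi x * `|h m x|),
    exists2 P, M P & forall m, is_condexp P (F m) xi (e m) &
    forall m P, M P -> \forall x \ae P, f m x = h m x * e m x]].

Definition setV F M : set (nat -> T -> \bar R) :=
  \bigcup_(xi in setA0 M) setL F M xi.

Definition setK F M : set (nat -> T -> \bar R) :=
  [set f | exists (n : nat) (C : 'I_n -> R) (v : 'I_n -> nat -> T -> \bar R),
    [/\ (1 <= n)%N, forall i, (0 <= C i)%R, forall i, setV F M (v i) &
        forall m P, M P -> \forall x \ae P,
          f m x = \sum_(i < n) (C i)%:E * v i m x]].

End processes.

(* Main.v *)
(* If [f = sum_i C_i h^i e^i] with [e^i_m = E(xi_i | F_m)], the increasing process
   [g_m = sum_i C_i sum_(k < m) (h^i_k - h^i_(k+1)) e^i_(k+1)] compensates [f]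
   under every measure of [M]: the densities being [F_1]-measurable, [e^i] is a
   version of the conditional expectation of [xi_i] under all of them.
   Conversely, if [N = f + g] is a martingale under every measure of [M], it is
   nonnegative and uniformly integrable, hence closed by some [xi >= 0], and
   [f = N + (- g) * 1] is a sum of two elements of the cone: [N_0] is a constant
   [c], the variable [xi / c] is in [A_0], and the constant [1] is in [A_0]. *)

From HB Require Import structures.
Require Import Defs.
From mathcomp Require Import all_boot all_order all_algebra.
From mathcomp Require Import all_classical all_reals all_analysis.
From mathcomp Require Import measurable_realfun ring lra.

Set Implicit Arguments.
Unset Strict Implicit.
Unset Printing Implicit Defensive.

Import Order.TTheory GRing.Theory Num.Theory.
Import numFieldNormedType.Exports.

Local Open Scope classical_set_scope.
Local Open Scope ring_scope.
Local Open Scope ereal_scope.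
Local Open Scope charge_scope.

(** * Conditional expectations under equivalent measures *)

Section conditional_expectation.
Context (R : realType) (d : measure_display) (T : measurableType d).
Implicit Types (F : nat -> set (set T)) (G H : set (set T)).
Implicit Types (P Q : probability T R) (M : set (probability T R)).
Implicit Types (X Y Z : T -> \bar R).

Import HBNNSimple.

Lemma measurable_g_sigma_algebraE G (A : set T) : sigma_algebra setT G ->
  measurable (A : set (g_sigma_algebraType G)) = G A.
Proof.
by move=> sG; rewrite -[measurable _]/(<<s G >> A) sigma_algebra_id.
Qed.

Lemma sub_measurable_measurable G X : G `<=` measurable ->
  sub_measurable G X -> measurable_fun setT X.
Proof.
move=> GM sX _ B mB; have := sX measurableT B mB.
rewrite -[measurable _]/(<<s G >> _).
by apply: smallest_sub => //; exact: sigma_algebra_measurable.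
Qed.

Lemma sub_measurableS G H X : G `<=` H ->
  sub_measurable G X -> sub_measurable H X.
Proof.
move=> GH sX _ B mB; have := sX measurableT B mB.
exact: sub_sigma_algebra2.
Qed.

(** The approximating sums see [X] only through its integrals over level sets of [h n], which lie in
    the sigma-algebra generated by [G]; two functions with the same integrals there can thus be
    compared. The limit is monotone convergence, and finiteness of [X] makes the products converge
    pointwise. *)
Lemma cvg_integral_mul_nnsfun_approx (mu : {measure set T -> \bar R}) G Z X
    (mZ : sub_measurable G Z) (h := nnsfun_approx measurableT mZ) :
  G `<=` measurable -> (forall x, 0 <= Z x) ->
  measurable_fun setT X -> (forall x, 0 <= X x) ->
  (forall x, X x \is a fin_num) ->
  \sum_(y \in range (h n)) y%:E * \int[mu]_(x in h n @^-1` [set y]) X x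
    @[n --> \oo] --> \int[mu]_x (Z x * X x).
Proof.
move=> GM Z0 mX X0 Xfin.
have mh n : measurable_fun setT (EFin \o (h n : T -> R)).
  apply: (@sub_measurable_measurable G) => //.
  rewrite /sub_measurable; apply/measurable_EFinP.
  exact: measurable_funP.
have hE n : \int[mu]_x ((h n x)%:E * X x) =
    \sum_(y \in range (h n)) y%:E * \int[mu]_(x in h n @^-1` [set y]) X x.
  have mhy y : measurable ((h n : T -> R) @^-1` [set y]).
    rewrite -[_ @^-1` _]setTI.
    by have /measurable_EFinP := mh n; apply.
  transitivity (\int[mu]_x (\sum_(y \in range (h n))
      (y * \1_(h n @^-1` [set y]) x)%:E * X x)).
    apply: eq_integral => x _.
    rewrite -ge0_mule_fsuml => [|y]; last exact: nnfun_muleindic_ge0.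
    by rewrite fsumEFin //; congr (_%:E * _); exact: (@fimfunE _ _ (h n) x).
  rewrite ge0_integral_fsum//; last 2 first.
  - move=> y; apply: emeasurable_funM => //; apply/measurable_EFinP.
    by apply: measurable_funM.
  - by move=> y x _; rewrite mule_ge0// nnfun_muleindic_ge0.
  apply: eq_fsbigr => y /[!inE] -[t _ hty].
  under eq_integral do rewrite EFinM -muleA.
  rewrite ge0_integralZl//.
  - rewrite [in RHS]integral_mkcond epatch_indic.
    by under eq_integral do rewrite muleC.
  - by apply: emeasurable_funM => //; apply/measurable_EFinP.
  - by move=> x _; rewrite mule_ge0 ?lee_fin.
  - by rewrite -hty lee_fin.
under eq_fun do rewrite -hE.
have ZE x : Z x * X x = limn (fun n => (h n x)%:E * X x).
  apply/esym/cvg_lim => //; apply: cvgeZr => //.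
  exact: cvg_nnsfun_approx.
have -> : \int[mu]_x (Z x * X x) =
    \int[mu]_x limn (fun n => (h n x)%:E * X x).
  by apply: eq_integral => x _.
apply: cvg_monotone_convergence => //.
- by move=> n; apply: emeasurable_funM (mh n) mX.
- by move=> n x _; rewrite mule_ge0 ?lee_fin.
- move=> x _ a b ab; rewrite lee_wpmul2r ?lee_fin//.
  by have /lefP/(_ x) := nd_nnsfun_approx measurableT mZ ab.
Qed.

(** Both sides are limits of simple-function sums that agree term by term, the level sets being in
    [G]. *)
Lemma ge0_integral_mulr_eq (mu : {measure set T -> \bar R}) G X Y Z :
  G `<=` measurable -> sigma_algebra setT G ->
  measurable_fun setT X -> (forall x, 0 <= X x) ->
  (forall x, X x \is a fin_num) ->
  measurable_fun setT Y -> (forall x, 0 <= Y x) ->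
  (forall x, Y x \is a fin_num) ->
  (forall A, G A -> \int[mu]_(x in A) X x = \int[mu]_(x in A) Y x) ->
  sub_measurable G Z -> (forall x, 0 <= Z x) ->
  \int[mu]_x (Z x * X x) = \int[mu]_x (Z x * Y x).
Proof.
move=> GM sG mX X0 Xfin mY Y0 Yfin XY mZ Z0.
have cX := @cvg_integral_mul_nnsfun_approx mu _ _ _ mZ GM Z0 mX X0 Xfin.
have cY := @cvg_integral_mul_nnsfun_approx mu _ _ _ mZ GM Z0 mY Y0 Yfin.
apply: (cvg_unique _ cX) => //.
apply: cvg_trans cY; apply: near_eq_cvg; near=> n.
apply: eq_fsbigr => y _; rewrite XY //.
rewrite -(measurable_g_sigma_algebraE _ sG) -[_ @^-1` _]setTI.
exact: measurable_funP.
Unshelve. all: by end_near. Qed.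

Lemma ae_integral_eq (mu : {measure set T -> \bar R}) A X Y : measurable A ->
  measurable_fun setT X -> measurable_fun setT Y ->
  (\forall x \ae mu, X x = Y x) -> \int[mu]_(x in A) X x = \int[mu]_(x in A) Y x.
Proof.
move=> mA mX mY XY; apply: ae_eq_integral => //; try exact: measurable_funTS.
by apply: filterS XY.
Qed.

Lemma ae_integral_ge0 (mu : {measure set T -> \bar R}) A X : measurable A ->
  measurable_fun setT X ->
  (\forall x \ae mu, 0 <= X x) -> 0 <= \int[mu]_(x in A) X x.
Proof.
move=> mA mX X0; rewrite (@ae_integral_eq _ _ _ X^\+) //.
- by apply: integral_ge0.
- exact: measurable_funepos.
- by apply: filterS X0 => x X0; rewrite funeposE max_l.
Qed.

Lemma ae_integrable_fine (mu : {measure set T -> \bar R}) X :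
  mu.-integrable setT X -> (\forall x \ae mu, 0 <= X x) ->
  \forall x \ae mu, X x = (fine (X^\+ x))%:E.
Proof.
move=> iX; apply: filterS2 (integrable_ae measurableT iX) => x /(_ I) Xfin X0.
by rewrite funeposE max_l// fineK.
Qed.

(** On [B] the integrand is negative, so a nonnegative integral must vanish; then [X] is zero almost
    everywhere on [B], which makes [B] null. *)
Lemma integral_ge0_ae_ge0 (mu : {measure set T -> \bar R}) X
    (B := [set x | X x < 0]) :
  measurable B -> mu.-integrable setT X -> 0 <= \int[mu]_(x in B) X x ->
  \forall x \ae mu, 0 <= X x.
Proof.
move=> mB iX XB0; have mX := measurable_int _ iX.
have : \int[mu]_(x in B) `|X x| = 0.
  apply/eqP; rewrite eq_le integral_ge0// andbT.
  rewrite (eq_integral (\- X)); last first.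
    by move=> x /[!inE] /ltW Xx; rewrite lee0_abs.
  rewrite integralN/=; first by rewrite oppe_le0.
  by apply: integrable_add_def => //; exact: integrableS iX.
move/(ae_eq_integral_abs mu mB (measurable_funTS mX)).
apply: filterS => x /= XB; rewrite leNgt; apply/negP => Xx.
by move: (Xx); rewrite XB// ltxx.
Qed.

Lemma condexp_ge0 P G X Y : G `<=` measurable -> sigma_algebra setT G ->
  is_condexp P G X Y -> (\forall x \ae P, 0 <= X x) -> \forall x \ae P, 0 <= Y x.
Proof.
move=> GM sG [iX iY mGY XY] X0.
have GB : G [set x | Y x < 0].
  rewrite -(measurable_g_sigma_algebraE _ sG) -[[set _ | _]]setTI.
  exact: emeasurable_fun_infty_o.
apply: integral_ge0_ae_ge0 => //; first exact: GM.
by rewrite XY//; apply: ae_integral_ge0 (GM _ GB) _ X0; exact: measurable_int iX.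
Qed.

(** The product is not assumed integrable: for nonnegative functions the equality also holds with
    both sides infinite. *)
Lemma ge0_condexp_mul P G X Y Z A : G `<=` measurable -> sigma_algebra setT G ->
  is_condexp P G X Y -> (\forall x \ae P, 0 <= X x) ->
  sub_measurable G Z -> (\forall x \ae P, 0 <= Z x) -> G A ->
  \int[P]_(x in A) (Z x * X x) = \int[P]_(x in A) (Z x * Y x).
Proof.
move=> GM sG XYc X0 mZ Z0 GA.
have Y0 := condexp_ge0 GM sG XYc X0; have [iX iY mGY XY] := XYc.
have mX := measurable_int _ iX; have mY := measurable_int _ iY.
have mA := GM _ GA.
(* Restricting to [A], which is in [G], keeps the factor [G]-measurable and turns integrals over [A]
   into integrals over the whole space. *)
pose Z' := Z^\+ \_ A.
have mGZ' : sub_measurable G Z'.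
  have mGA : measurable (A : set (g_sigma_algebraType G)).
    by rewrite measurable_g_sigma_algebraE.
  apply/(measurable_restrictT _ mGA).
  exact/measurable_funTS/measurable_funepos.
have mZ' := sub_measurable_measurable GM mGZ'.
have mT := sub_measurable_measurable GM mZ.
(* [fpos W] equals [W] almost everywhere when [W] is integrable and almost surely nonnegative, and
   it is nonnegative and finite at every point. *)
pose fpos (X : T -> \bar R) x := (fine (X^\+ x))%:E.
have mfpos W : measurable_fun setT W -> measurable_fun setT (fpos W).
  move=> mW; apply/measurable_EFinP; apply: measurableT_comp => //.
  exact: measurable_funepos.
have fpos0 W x : 0 <= fpos W x by rewrite lee_fin fine_ge0.
have H W : P.-integrable setT W -> (\forall x \ae P, 0 <= W x) ->
    \int[P]_(x in A) (Z x * W x) = \int[P]_x (Z' x * fpos W x).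
  move=> iW W0; have mW := measurable_int _ iW.
  transitivity (\int[P]_(x in A) (Z^\+ x * fpos W x)).
    apply: ae_integral_eq => //.
    - exact: emeasurable_funM.
    - by apply: emeasurable_funM (mfpos _ mW); exact: measurable_funepos.
    apply: filterS2 (ae_integrable_fine iW W0) Z0 => x Wx Zx.
    by rewrite -[fpos W x]Wx funeposE max_l.
  rewrite integral_mkcond; apply: eq_integral => x _.
  by rewrite /Z' !patchE; case: ifP; rewrite ?mul0e.
rewrite !H//; apply: (@ge0_integral_mulr_eq _ G) => //; try exact: mfpos.
- move=> B GB; have mB := GM _ GB.
  rewrite -(@ae_integral_eq P B X (fpos X))//; last 2 first.
  - exact: mfpos.
  - exact: ae_integrable_fine.
  rewrite -(@ae_integral_eq P B Y (fpos Y)) ?XY//; first exact: mfpos.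
  exact: ae_integrable_fine.
- by move=> x; rewrite /Z' patchE; case: ifP.
Qed.

(** The Radon-Nikodym derivative of a charge may be negative on a null set; it agrees almost
    everywhere with the derivative built for measures, which is nonnegative everywhere. *)
Lemma density_ge0 P Q : P `<< Q -> \forall x \ae Q, 0 <= density P Q x.
Proof.
move=> PQ.
have := ae_eq_Radon_Nikodym_SigmaFinite PQ measurableT.
apply: filterS => x /(_ I); rewrite /density => <-.
exact: Radon_Nikodym_SigmaFinite.f_ge0.
Qed.

Lemma measurable_density P Q : P `<< Q -> measurable_fun setT (density P Q).
Proof. by move=> PQ; rewrite /density. Qed.

Lemma ge0_integral_density P Q X A : P `<< Q -> measurable A ->
  measurable_fun setT X -> (\forall x \ae Q, 0 <= X x) ->
  \int[P]_(x in A) X x = \int[Q]_(x in A) (density P Q x * X x).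
Proof.
move=> PQ mA mX X0.
have X0P : \forall x \ae P, 0 <= X x.
  case: X0 => N [mN N0 XN]; exists N; split => //.
  by move/null_content_dominatesP : PQ; apply.
rewrite (@ae_integral_eq _ _ _ X^\+)//; first last.
- by apply: filterS X0P => x ?; rewrite funeposE max_l.
- exact: measurable_funepos.
rewrite -(Radon_Nikodym_SigmaFinite.change_of_variables PQ)//; last first.
  exact/measurable_funTS/measurable_funepos.
apply: ae_integral_eq => //.
- apply: emeasurable_funM; first exact: measurable_funepos.
  exact: measurable_int (Radon_Nikodym_SigmaFinite.f_integrable PQ).
- by apply: emeasurable_funM => //; exact: measurable_density.
have := ae_eq_Radon_Nikodym_SigmaFinite PQ measurableT.
apply: filterS2 X0 => x Xx /(_ I); rewrite /density => <-.
by rewrite muleC funeposE max_l.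
Qed.

Lemma ae_dominated P Q (S : set T) : P `<< Q ->
  (\forall x \ae Q, S x) -> \forall x \ae P, S x.
Proof.
move=> PQ [N [mN N0 SN]]; exists N; split => //.
by move/null_content_dominatesP : PQ; apply.
Qed.

(** For signed [Z], the nonnegative case applied to [|Z|] first transfers integrability from [Z X]
    to [Z Y]; applied to the positive and negative parts of [Z], it then gives the equality by
    subtraction. *)
Lemma condexp_mul P G X Y Z : G `<=` measurable -> sigma_algebra setT G ->
  is_condexp P G X Y -> (\forall x \ae P, 0 <= X x) ->
  sub_measurable G Z -> P.-integrable setT (fun x => X x * `|Z x|) ->
  [/\ P.-integrable setT (fun x => Z x * X x),
      P.-integrable setT (fun x => Z x * Y x) &
      forall A, G A ->
        \int[P]_(x in A) (Z x * Y x) = \int[P]_(x in A) (Z x * X x)].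
Proof.
move=> GM sG XYc X0 mGZ iXZ.
have Y0 := condexp_ge0 GM sG XYc X0; have [iX iY _ _] := XYc.
have mZ := sub_measurable_measurable GM mGZ.
have GT : G setT by rewrite -measurable_g_sigma_algebraE.
have mGabs : sub_measurable G (abse \o Z) by exact: measurableT_comp.
have mabs := sub_measurable_measurable GM mGabs.
have intM W : P.-integrable setT W -> (\forall x \ae P, 0 <= W x) ->
    \int[P]_x (`|Z x| * W x) = \int[P]_x (`|Z x| * X x) ->
    P.-integrable setT (fun x => Z x * W x).
  move=> /measurable_int mW W0 WX; apply/integrableP; split.
    exact: emeasurable_funM.
  rewrite (@ae_integral_eq P _ _ (fun x => `|Z x| * W x))//.
  - rewrite WX; have /integrableP[_] := iXZ; apply: le_lt_trans.
    rewrite le_eqVlt; apply/orP; left; apply/eqP.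
    apply: ae_integral_eq => //.
    + by apply: emeasurable_funM => //; exact: measurable_int iX.
    + by apply: measurableT_comp => //; exact: measurable_int iXZ.
    by apply: filterS X0 => x Xx; rewrite abseM abse_id (gee0_abs Xx) muleC.
  - by apply: measurableT_comp => //; exact: emeasurable_funM.
  - exact: emeasurable_funM.
  by apply: filterS W0 => x Wx; rewrite abseM (gee0_abs Wx).
have aZ0 : \forall x \ae P, 0 <= (abse \o Z) x by apply: aeW => x /=.
have iZX : P.-integrable setT (fun x => Z x * X x) by exact: intM.
have iZY : P.-integrable setT (fun x => Z x * Y x).
  by apply: intM => //; exact/esym/(ge0_condexp_mul GM sG XYc X0 mGabs aZ0 GT).
split=> // A GA; have mA := GM _ GA.
have absZ x : `|Z x| = Z^\+ x + Z^\- x.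
  by rewrite -[LHS]/((abse \o Z) x) fune_abse.
(* Each part is dominated by [|Z| W], so the difference of the integrals is well defined. *)
have split_ W : P.-integrable setT W -> (\forall x \ae P, 0 <= W x) ->
    P.-integrable setT (fun x => Z x * W x) ->
    \int[P]_(x in A) (Z x * W x) =
    \int[P]_(x in A) (Z^\+ x * W x) - \int[P]_(x in A) (Z^\- x * W x).
  move=> iW W0 iZW; have mW := measurable_int _ iW.
  have mp : measurable_fun setT (fun x => Z^\+ x * W x).
    by apply: emeasurable_funM => //; exact: measurable_funepos.
  have mn : measurable_fun setT (fun x => Z^\- x * W x).
    by apply: emeasurable_funM => //; exact: measurable_funeneg.
  have ip : P.-integrable setT (fun x => Z^\+ x * W x).
    apply: le_integrable iZW => // x _.
    by rewrite !abseM lee_wpmul2r// absZ gee0_abs// leeDl.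
  have in_ : P.-integrable setT (fun x => Z^\- x * W x).
    apply: le_integrable iZW => // x _.
    by rewrite !abseM lee_wpmul2r// absZ gee0_abs// leeDr.
  rewrite -integralB//; [|exact: integrableS ip|exact: integrableS in_].
  apply: ae_integral_eq => //.
  - exact: emeasurable_funM.
  - exact: emeasurable_funB.
  apply: filterS (integrable_ae measurableT iW) => x /(_ I) Wfin.
  by rewrite {1}(funeposneg Z) muleBl// add_def_funeposneg.
rewrite (split_ Y)// (split_ X)//; congr (_ - _); apply/esym.
- apply: (ge0_condexp_mul GM sG) => //; last exact: aeW.
  exact: measurable_funepos.
- apply: (ge0_condexp_mul GM sG) => //; last exact: aeW.
  exact: measurable_funeneg.
Qed.

Lemma filtration_le F k m : is_filtration F -> (k <= m)%N -> F k `<=` F m.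
Proof.
move=> [_ FS _ _ _]; elim: m => [|m IH]; first by rewrite leqn0 => /eqP ->.
rewrite leq_eqVlt ltnS => /predU1P[->//|/IH km].
exact: subset_trans (FS m).
Qed.

(** The preimage of the value at [point] contains [point], so it is not empty and must be the whole
    space. *)
Lemma sub_measurable_trivial X : sub_measurable [set set0; setT] X ->
  exists c, forall x, X x = c.
Proof.
move=> mX; exists (X point) => x.
have sT : sigma_algebra setT [set set0; @setT T].
  split; first by left.
  - by move=> A [] ->; rewrite ?setD0 ?setDT; [right|left].
  - move=> A HA; have [[n An]|nA] := pselect (exists n, A n = setT).
      by right; apply/seteqP; split=> // y _; exists n => //; rewrite An.
    left; apply/seteqP; split=> // y [n _]; case: (HA n) => An; rewrite An//.
    by move=> _; apply: nA; exists n.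
have : [set set0; setT] (X @^-1` [set X point]).
  rewrite -(measurable_g_sigma_algebraE _ sT) -[_ @^-1` _]setTI.
  exact: mX.
case=> E.
  by have : set0 (@point T) by rewrite -E.
by have : setT x by []; rewrite -E.
Qed.

(** The density has a version [D] measurable for [F 1], hence for [F j] when [j >= 1], so it can be
    pulled out: the [P]-integrals of [Y] and [X] over [A] are the [Q]-integrals of [D Y] and [D X],
    which coincide. *)
Lemma condexp_change F M P0 P Q j X Y A : is_filtration F ->
  equivalent_measures M -> F1_densities F M P0 -> M P -> M Q -> (1 <= j)%N ->
  is_condexp Q (F j) X Y -> (\forall x \ae Q, 0 <= X x) -> F j A ->
  \int[P]_(x in A) Y x = \int[P]_(x in A) X x.
Proof.
move=> fF eM dM MP MQ j1 XYc X0 FjA.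
have [sF _ FM _ _] := fF; have [PQ QP] := eM _ _ MP MQ.
have Y0 := condexp_ge0 (FM j) (sF j) XYc X0.
have [[D mD DE] _] := dM _ _ MP MQ.
have mA := FM _ _ FjA.
have mFD : sub_measurable (F j) D.
  exact: sub_measurableS (filtration_le fF j1) mD.
have mD' := sub_measurable_measurable (FM j) mFD.
have D0 : \forall x \ae Q, 0 <= D x.
  by apply: filterS2 (density_ge0 PQ) DE => x Dx /(_ I) ->.
have H W : Q.-integrable setT W -> (\forall x \ae Q, 0 <= W x) ->
    \int[P]_(x in A) W x = \int[Q]_(x in A) (D x * W x).
  move=> /measurable_int mW W0; rewrite (ge0_integral_density PQ)//.
  apply: ae_integral_eq => //.
  - by apply: emeasurable_funM => //; exact: measurable_density.
  - exact: emeasurable_funM.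
  by apply: filterS DE => x /(_ I) ->.
have [iX iY _ _] := XYc.
by rewrite !H// (ge0_condexp_mul (FM j) (sF j) XYc).
Qed.

(** This is the independence of the conditional expectation from the measure. Time 0 is out of reach
    of the density argument and relies on [xi] having the same expectation 1 under all measures. *)
Lemma condexp_setA0 F M P0 P Q j xi e : is_filtration F ->
  equivalent_measures M -> F1_densities F M P0 -> M P -> M Q ->
  setA0 M xi -> is_condexp Q (F j) xi e -> is_condexp P (F j) xi e.
Proof.
move=> fF eM dM MP MQ Axi xie.
have [sF _ FM F0 _] := fF.
have [PQ QP] := eM _ _ MP MQ.
have [iPxi Pxi0 Pxi1] := Axi _ MP; have [iQxi Qxi0 Qxi1] := Axi _ MQ.
have [_ iQe mFe xieE] := xie.
have eE A : F j A -> \int[P]_(x in A) e x = \int[P]_(x in A) xi x.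
  case: (posnP j) => [j0|j1 FA]; last first.
    exact: (condexp_change fF eM dM MP MQ j1 xie).
  (* At time 0 the variable [e] is a constant [c], and its integral over the whole space is [c]
     under [P] and under [Q] alike. *)
  move: (mFe) xieE; rewrite j0 F0 => /sub_measurable_trivial[c ec] xieE.
  case=> ->; first by rewrite !integral_set0.
  rewrite Pxi1 -Qxi1 -xieE; last by right.
  under eq_integral do rewrite ec.
  under [RHS]eq_integral do rewrite ec.
  rewrite !integral_cst//; congr (_ * _).
  exact: etrans (probability_setT P) (esym (probability_setT Q)).
have mT := sub_measurable_measurable (FM j) mFe.
have FjT : F j setT by rewrite -measurable_g_sigma_algebraE.
split => //; apply/integrableP; split => //.
rewrite (@ae_integral_eq P _ _ e)//.
- by rewrite eE// Pxi1 ltry.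
- exact: measurableT_comp.
apply: (ae_dominated PQ).
apply: filterS (condexp_ge0 (FM j) (sF j) xie Qxi0) => x.
by move/gee0_abs.
Qed.

End conditional_expectation.

(** * Compensators of the elements of the cone *)

Section local_regularity.
Context (R : realType) (d : measure_display) (T : measurableType d).
Implicit Types (F : nat -> set (set T)) (P Q : probability T R).
Implicit Types (M : set (probability T R)) (X Y xi : T -> \bar R).
Implicit Types (f g v w h e : nat -> T -> \bar R).

Lemma ae_integrable (mu : {measure set T -> \bar R}) X Y :
  measurable_fun setT Y -> (\forall x \ae mu, X x = Y x) ->
  mu.-integrable setT X -> mu.-integrable setT Y.
Proof.
move=> mY XY /integrableP[mX iX]; apply/integrableP; split=> //.
rewrite -(@ae_integral_eq _ _ _ mu _ (abse \o X))//; try exact: measurableT_comp.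
by apply: filterS XY => x /= ->.
Qed.

Lemma ae_fin_num (mu : {measure set T -> \bar R}) X :
  mu.-integrable setT X -> \forall x \ae mu, X x \is a fin_num.
Proof. by move=> /(integrable_ae measurableT); apply: filterS => x; apply. Qed.

Lemma sub_measurableB (G : set (set T)) X Y :
  sub_measurable G X -> sub_measurable G Y -> sub_measurable G (X \- Y).
Proof. exact: emeasurable_funB. Qed.

Lemma sub_measurableM (G : set (set T)) X Y :
  sub_measurable G X -> sub_measurable G Y -> sub_measurable G (X \* Y).
Proof. exact: emeasurable_funM. Qed.

Lemma sub_measurable_sum (G : set (set T)) (I : Type) (s : seq I)
    (X : I -> T -> \bar R) : (forall i, sub_measurable G (X i)) ->
  sub_measurable G (fun x => \sum_(i <- s) X i x).
Proof. by move=> mX; apply: emeasurable_sum. Qed.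

(* [h_(m+1) e_(m+1) + (h_m - h_(m+1)) e_(m+1) = h_m e_(m+1)], and [h_m] is
   [F_m]-measurable, so that the sum with [g] is a martingale. *)
Lemma setV_compensator F M P0 v : is_filtration F ->
  equivalent_measures M -> F1_densities F M P0 -> setV F M v ->
  exists w g, [/\ adapted F w, adapted F g, forall x, g 0%N x = 0 &
    forall P, M P ->
    [/\ forall m, \forall x \ae P, v m x = w m x,
        forall m, \forall x \ae P, 0 <= g m x,
        forall m, \forall x \ae P, g m x <= g m.+1 x,
        forall m, P.-integrable setT (w m) /\ P.-integrable setT (g m) &
        forall m A, F m A ->
          \int[P]_(x in A) (w m.+1 x + g m.+1 x) =
          \int[P]_(x in A) (w m x + g m x)]].
Proof.
move=> fF eM dM [xi Axi [h [e [[ah hfin hdec] ixih [Q MQ xie] vE]]]].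
have [sF FS FM _ _] := fF.
(* [v] is only almost surely equal to this product; [w] is the version that is adapted. *)
pose w m x := h m x * e m x.
pose g m x := \sum_(k < m) (h k x - h k.+1 x) * e k.+1 x.
have ae_ : adapted F e by move=> m; have [] := xie m.
have aw : adapted F w by move=> m; exact: sub_measurableM.
have ahS m : sub_measurable (F m.+1) (h m) by exact: sub_measurableS (ah m).
have ag : adapted F g.
  move=> m; apply: sub_measurable_sum => i.
  apply: sub_measurableM.
    apply: sub_measurableB.
      exact: sub_measurableS (filtration_le fF (ltnW (ltn_ord i))) (ah i).
    exact: sub_measurableS (filtration_le fF (ltn_ord i)) (ah i.+1).
  exact: sub_measurableS (filtration_le fF (ltn_ord i)) (ae_ i.+1).
have mF X m : sub_measurable (F m) X -> measurable_fun setT X.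
  exact: sub_measurable_measurable.
exists w, g; split => // [x|P MP]; first by rewrite /g big_ord0.
have [ixi xi0 _] := Axi _ MP.
have eP m : is_condexp P (F m) xi (e m) by exact: (condexp_setA0 fF eM dM MP MQ).
have e0 m := condexp_ge0 (FM m) (sF m) (eP m) xi0.
have efin m : \forall x \ae P, e m x \is a fin_num.
  by apply: ae_fin_num; have [] := eP m.
have {}hfin m : \forall x \ae P, h m x \is a fin_num.
  by apply: filterS (hfin m P MP) => x; rewrite fin_num_abs.
have [hxi he pull] : [/\ forall m, P.-integrable setT (fun x => h m x * xi x),
    forall m, P.-integrable setT (w m) &
    forall m A, F m A ->
      \int[P]_(x in A) (h m x * e m x) = \int[P]_(x in A) (h m x * xi x)].
  by split=> m; have [] :=
    condexp_mul (FM m) (sF m) (eP m) xi0 (ah m) (ixih m P MP).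
(* The coefficient of time [m] is paired with the conditional expectation at time [m.+1], so that
   [h m * e m.+1] and [h m * e m] both integrate like [h m * xi] over sets of [F m]. *)
have [heS pullS] : (forall m, P.-integrable setT (fun x => h m x * e m.+1 x)) /\
    forall m A, F m.+1 A ->
      \int[P]_(x in A) (h m x * e m.+1 x) = \int[P]_(x in A) (h m x * xi x).
  by split=> m; have [] :=
    condexp_mul (FM m.+1) (sF m.+1) (eP m.+1) xi0 (ahS m) (ixih m P MP).
have dE m : \forall x \ae P,
    h m x * e m.+1 x - w m.+1 x = (h m x - h m.+1 x) * e m.+1 x.
  apply: filterS3 (hfin m) (hfin m.+1) (efin m.+1) => x h0 h1 e1.
  by rewrite muleBl// fin_num_adde_defr.
(* The increment is integrable as a difference of two integrable products. *)
have id_ m : P.-integrable setT (fun x => (h m x - h m.+1 x) * e m.+1 x).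
  apply: ae_integrable (dE m) _; last exact: integrableB.
  apply: emeasurable_funM; last exact: mF (ae_ _).
  by apply: emeasurable_funB; apply: mF (ah _).
have ig m : P.-integrable setT (g m) by apply: integrable_sum => // k _.
have d0 m : \forall x \ae P, 0 <= (h m x - h m.+1 x) * e m.+1 x.
  apply: filterS3 (hdec m P MP) (e0 m.+1) (hfin m.+1) => x hx ex hf.
  by rewrite mule_ge0// sube_ge0// hf.
have gS m x : g m.+1 x = g m x + (h m x - h m.+1 x) * e m.+1 x.
  by rewrite /g big_ord_recr.
split => //.
- by move=> m; apply: vE.
- elim=> [|m IH]; first by apply: aeW => x; rewrite /g big_ord0.
  by apply: filterS2 IH (d0 m) => x gx dx; rewrite gS adde_ge0.
- by move=> m; apply: filterS (d0 m) => x dx; rewrite gS leeDl.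
move=> m A FA; have mA := FM _ _ FA.
have mw k : measurable_fun setT (w k) by exact: measurable_int (he k).
have mg k : measurable_fun setT (g k) by exact: measurable_int (ig k).
have iS X : P.-integrable setT X -> P.-integrable A X by exact: integrableS.
transitivity (\int[P]_(x in A) (h m x * e m.+1 x + g m x)).
  apply: ae_integral_eq => //.
  - exact: emeasurable_funD.
  - by apply: emeasurable_funD => //; exact: measurable_int (heS m).
  apply: filterS3 (filterI (hfin m) (hfin m.+1)) (efin m.+1)
    (ae_fin_num (ig m)) => x [].
  rewrite gS /w; move: (h m x) (h m.+1 x) (e m.+1 x) (g m x).
  move=> [a| |] [b| |] [c| |] [u| |]// _ _ _ _.
  by rewrite -!EFinM -!EFinD; congr EFin; ring.
rewrite integralD ?iS// [RHS]integralD ?iS//; congr (_ + _).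
by rewrite pullS ?pull//; exact: FS.
Qed.

Lemma martingaleS F P f : is_filtration F -> adapted F f ->
  (forall m, P.-integrable setT (f m)) ->
  (forall m A, F m A -> \int[P]_(x in A) f m.+1 x = \int[P]_(x in A) f m x) ->
  martingale F P f.
Proof.
move=> fF af intf fS; split => // k m km; split => // A FA.
elim: m km => [|m IH]; first by rewrite leqn0 => /eqP ->.
rewrite leq_eqVlt ltnS => /predU1P[->//|km].
by rewrite IH// fS//; exact: filtration_le FA.
Qed.

Lemma ae_le_integral (mu : {measure set T -> \bar R}) A X Y : measurable A ->
  mu.-integrable setT X -> mu.-integrable setT Y ->
  (\forall x \ae mu, X x <= Y x) ->
  \int[mu]_(x in A) X x <= \int[mu]_(x in A) Y x.
Proof.
move=> mA iX iY XY.
have iS Z : mu.-integrable setT Z -> mu.-integrable A Z by exact: integrableS.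
rewrite -sube_ge0; last by rewrite integrable_fin_num//; exact: iS.
rewrite -integralB ?iS//; apply: ae_integral_ge0 => //.
  by apply: emeasurable_funB; [exact: measurable_int iY|exact: measurable_int iX].
by apply: filterS2 XY (ae_fin_num iX) => x XYx Xx; rewrite sube_ge0// Xx.
Qed.

(** The variable [f 0] is constant because [F 0] is trivial, so its expectation is one number for
    all measures, and the super-martingale inequality bounds every later expectation by it. *)
Lemma supermartingale_bound F M P0 f : is_filtration F -> M P0 ->
  supermartingale F M f -> exists c : R, forall P m, M P ->
    P.-integrable setT (f m) /\ \int[P]_x f m x <= c%:E.
Proof.
move=> [sF _ FM F0 _] MP0 [af _ cf].
(* [supermartingale] states integrability from time 1 on; at time 0 it is read off the conditional
   expectation with [k = m = 0]. *)
have i0 P : M P -> P.-integrable setT (f 0%N).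
  by move=> MP; have [Y [] ] := cf 0%N 0%N P (leqnn _) MP.
have [c fc] : exists c, forall x, f 0%N x = c.
  by apply: sub_measurable_trivial; rewrite -F0; exact: af.
have cE P : \int[P]_x f 0%N x = c.
  under eq_integral do rewrite fc.
  rewrite integral_cst//; transitivity (c * 1); last by rewrite mule1.
  by congr (_ * _); exact: probability_setT.
have cfin : c \is a fin_num.
  by rewrite -(cE P0); apply: integrable_fin_num => //; exact: i0.
exists (fine c) => P m MP.
have [Y [im iY _ YE] Yf] := cf 0%N m P (leq0n _) MP.
split=> //; rewrite fineK// -(cE P) -YE; last by rewrite F0; right.
by apply: ae_le_integral => //; exact: i0.
Qed.

Lemma integral_abse_ae_ge0 (mu : {measure set T -> \bar R}) X :
  measurable_fun setT X -> (\forall x \ae mu, 0 <= X x) ->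
  \int[mu]_x `|X x| = \int[mu]_x X x.
Proof.
move=> mX X0; apply: ae_integral_eq => //; first exact: measurableT_comp.
by apply: filterS X0 => x; exact: gee0_abs.
Qed.

Lemma sup_norm1_lty M X (c : R) :
  (forall P, M P -> \int[P]_x `|X x| <= c%:E) -> sup_norm1 M X < +oo.
Proof.
move=> Xc; apply: (@le_lt_trans _ _ c%:E); last exact: ltry.
by apply: ge_ereal_sup => _ [P MP <-]; exact: Xc.
Qed.

Lemma setK_local_regular F M P0 f : is_filtration F ->
  equivalent_measures M -> M P0 -> F1_densities F M P0 ->
  supermartingale F M f -> nonneg_process M f -> setK F M f ->
  local_regular F M f.
Proof.
move=> fF eM MP0 dM sf f0 [n [C [v [_ C0 Vv fv]]]].
have [sF FS FM F0 _] := fF.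
have [c fc] := supermartingale_bound fF MP0 sf.
have mf m : measurable_fun setT (f m).
  by have [/measurable_int] := fc P0 m MP0.
have /choice[w /choice[k wk]] : forall i, exists w k,
    [/\ adapted F w, adapted F k, forall x, k 0%N x = 0 & forall P, M P ->
    [/\ forall m, \forall x \ae P, v i m x = w m x,
        forall m, \forall x \ae P, 0 <= k m x,
        forall m, \forall x \ae P, k m x <= k m.+1 x,
        forall m, P.-integrable setT (w m) /\ P.-integrable setT (k m) &
        forall m A, F m A ->
          \int[P]_(x in A) (w m.+1 x + k m.+1 x) =
          \int[P]_(x in A) (w m x + k m x)]].
  by move=> i; exact: (setV_compensator fF eM dM (Vv i)).
pose g m x := \sum_(i < n) (C i)%:E * k i m x.
have ag : adapted F g.
  move=> m; apply: sub_measurable_sum => i.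
  by apply: measurable_funeM; have [_ /(_ m)] := wk i.
have g0 m P : M P -> \forall x \ae P, 0 <= g m x.
  move=> MP; have : \forall x \ae P, forall i, 0 <= k i m x.
    by apply: filter_forall => i; have [_ _ _ /(_ P MP)[_ /(_ m)]] := wk i.
  by apply: filterS => x kx; rewrite sume_ge0// => i _; rewrite mule_ge0 ?lee_fin.
have ig m P : M P -> P.-integrable setT (g m).
  move=> MP; apply: integrable_sum => // i _; apply: integrableZl => //.
  by have [_ _ _ /(_ P MP)[_ _ _ /(_ m)[]]] := wk i.
have mart P : M P -> martingale F P (fun m x => f m x + g m x).
  move=> MP; apply: martingaleS => //.
  - move=> m; apply: emeasurable_funD; last exact: ag.
    by case: sf => /(_ m).
  - by move=> m; apply: integrableD => //; [have [] := fc P m MP|exact: ig].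
  (* [f m + g m] is almost surely this combination; distributing [C i] uses that [w] and [k] are
     almost surely finite. The one-step equality then follows by linearity. *)
  pose N m x := \sum_(i < n) (C i)%:E * (w i m x + k i m x).
  have iwk i m : P.-integrable setT (fun x => w i m x + k i m x).
    have [_ _ _ /(_ P MP)[_ _ _ /(_ m)[iw ik] _]] := wk i.
    exact: integrableD.
  have NE m A : measurable A -> \int[P]_(x in A) (f m x + g m x) =
      \sum_(i < n) (C i)%:E * \int[P]_(x in A) (w i m x + k i m x).
    move=> mA; transitivity (\int[P]_(x in A) N m x).
      apply: ae_integral_eq => //.
      - apply: emeasurable_funD => //; exact: measurable_int (ig m _ MP).
      - apply: emeasurable_sum => i; apply: measurable_funeM.
        exact: measurable_int (iwk i m).
      have : \forall x \ae P, forall i,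
          [/\ v i m x = w i m x, w i m x \is a fin_num & k i m x \is a fin_num].
        apply: filter_forall => i.
        have [_ _ _ /(_ P MP)[/(_ m) vw _ _ /(_ m)[iw ik] _]] := wk i.
        by apply: filterS3 vw (ae_fin_num iw) (ae_fin_num ik).
      apply: filterS2 (fv m P MP) => x -> vx.
      rewrite /g -big_split; apply: eq_bigr => i _ /=.
      by have [-> wf kf] := vx i; rewrite muleDr// fin_num_adde_defr.
    rewrite integral_sum//; last first.
      by move=> i; apply: integrableZl => //; exact: integrableS (iwk i m).
    apply: eq_bigr => i _; rewrite integralZl//.
    exact: integrableS (iwk i m).
  move=> m A FA; have mA := FM _ _ FA.
  rewrite !NE//; apply: eq_bigr => i _; congr (_ * _).
  by have [_ _ _ /(_ P MP)[_ _ _ _ ->]] := wk i.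
split => //.
  move=> m _; apply: (@sup_norm1_lty _ _ c) => P MP.
  by rewrite integral_abse_ae_ge0//; [have [] := fc P m MP|exact: f0].
exists g; split => //.
- move=> m P MP; have : \forall x \ae P, forall i, k i m x <= k i m.+1 x.
    by apply: filter_forall => i; have [_ _ _ /(_ P MP)[_ _ /(_ m)]] := wk i.
  apply: filterS => x kx; apply: lee_sum => i _.
  by rewrite lee_wpmul2l ?lee_fin.
- move=> P MP; apply: aeW => x; rewrite /g big1// => i _.
  by have [_ _ -> _] := wk i; rewrite mule0.
- move=> m _; apply: (@sup_norm1_lty _ _ c) => P MP.
  have mg := measurable_int _ (ig m _ MP).
  rewrite integral_abse_ae_ge0//; last exact: g0.
  (* As [f m >= 0], the integral of [g m] is at most that of [f m + g m], which by the martingale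
     property and [g 0 = 0] is the integral of [f 0]. *)
  apply: (@le_trans _ _ (\int[P]_x (f m x + g m x))).
    apply: ae_le_integral => //; first exact: ig.
      by apply: integrableD; [| have [] := fc P m MP|exact: ig].
    by apply: filterS (f0 m P MP) => x fx; rewrite leeDr.
  have [_ /(_ 0%N m (leq0n _))[_ _ _ <-]] := mart P MP; last by rewrite F0; right.
  rewrite (@ae_integral_eq _ _ _ P _ _ (f 0%N))//.
  + by have [] := fc P 0%N MP.
  + by apply: emeasurable_funD => //; exact: measurable_int (ig 0%N _ MP).
  apply: aeW => x; rewrite /g big1 ?adde0// => i _.
  by have [_ _ -> _] := wk i; rewrite mule0.
Qed.

End local_regularity.

(** * Closing a uniformly integrable martingale *)

Section martingale_closure.
Context (R : realType) (d : measure_display) (T : measurableType d).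
Implicit Types (F : nat -> set (set T)) (P : probability T R).
Implicit Types (N : nat -> T -> \bar R).

(** Compactness of [[a, b]] provides a cluster point, and an ultrafilter converges to each of its
    cluster points. *)
Lemma ultra_bounded_cvg (U : set_system nat) (u : nat -> R) (a b : R) :
  UltraFilter U -> (forall n, (a <= u n <= b)%R) ->
  cvg (u n @[n --> U]).
Proof.
move=> UU uab.
have [|l [_ cl]] := @segment_compact _ a b (u n @[n --> U]) _.
  by apply: (@filterE _ U) => n; rewrite /= in_itv/= uab.
apply/cvg_ex; exists l => B lB.
have [//|UB] := in_ultra_setVsetC (u @^-1` B) UU.
by have [x [nBx Bx]] := cl (~` B) B UB lB.
Qed.

(* The limit of [\int_A N_m] along an ultrafilter is additive in [A] and equal
   to [\int_A N_k] for [A] in [F_k]; absolute continuity uniform in [m] makes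
   it countably additive, so that it has a density. *)
Lemma martingale_closed F P N : is_filtration F -> martingale F P N ->
  (forall m, \forall x \ae P, 0 <= N m x) ->
  (forall eps : R, (0 < eps)%R -> exists2 delta : R, (0 < delta)%R &
    forall m A, measurable A -> P A < delta%:E ->
      \int[P]_(x in A) N m x <= eps%:E) ->
  exists2 xi, (\forall x \ae P, 0 <= xi x) &
    forall m, is_condexp P (F m) xi (N m).
Proof.
move=> fF [aN cN] N0 Nac.
have [sF FS FM F0 _] := fF.
have iN m : P.-integrable setT (N m) by have [] := cN m m (leqnn _).
have mN m := measurable_int _ (iN m).
have [U [UU oU]] := @ultraFilterLemma _ (\oo : set_system nat) _.
pose a m A := fine (\int[P]_(x in A) N m x).
have iNfin m A : measurable A -> \int[P]_(x in A) N m x \is a fin_num.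
  by move=> mA; apply: integrable_fin_num => //; exact: integrableS (iN m).
have aE m A : measurable A -> (a m A)%:E = \int[P]_(x in A) N m x.
  by move=> mA; rewrite fineK// iNfin.
have a0 m A : measurable A -> (0 <= a m A)%R.
  by move=> mA; rewrite -lee_fin aE//; exact: ae_integral_ge0.
have aU m A B : measurable A -> measurable B -> [disjoint A & B] ->
  a m (A `|` B) = (a m A + a m B)%R.
  move=> mA mB AB; apply: EFin_inj; rewrite EFinD !aE//; last exact: measurableU.
  by rewrite integral_setU//; exact: measurable_funTS.
have aT m A : measurable A -> (a m A <= a 0%N setT)%R.
  move=> mA; have -> : a 0%N setT = a m setT.
    have [_ _ _ E] := cN 0%N m (leq0n _); apply: EFin_inj; rewrite !aE// E//.
    by rewrite F0; right.
  rewrite -(setUv A) aU ?lerDl ?a0//; [exact: measurableC..|].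
  exact/disj_set2P/setICr.
have acvg A : measurable A -> cvg (a m A @[m --> U]).
  move=> mA; apply: (@ultra_bounded_cvg U _ 0%R (a 0%N setT)) => m.
  by rewrite a0//= aT.
pose l A := lim (a m A @[m --> U]).
have l0 A : measurable A -> (0 <= l A)%R.
  by move=> mA; apply: limr_ge; [exact: acvg|apply: filterE => m; exact: a0].
have lU A B : measurable A -> measurable B -> [disjoint A & B] ->
    l (A `|` B) = (l A + l B)%R.
  move=> mA mB AB; apply: cvg_lim => //.
  under eq_cvg do rewrite aU//.
  by apply: cvgD; exact: acvg.
(* [U] refines [\oo], so sequences that are eventually constant keep their value. This gives [l] on
   the empty set, on null sets and on each [F m]. *)
have lc A (r : R) : measurable A -> \oo [set m | a m A = r] -> l A = r.
  move=> mA /oU ar; apply: cvg_lim => //.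
  by apply: cvg_near_cst; apply: filterS ar.
have ls : l set0 = 0%R.
  by apply: lc => //; apply: filterE => m /=; rewrite /a integral_set0.
pose nu A := (l A)%:E.
have nusum : semi_sigma_additive nu.
  move=> A mA tA mUA.
  have mS n : measurable (\big[setU/set0]_(i < n) A i).
    exact: bigsetU_measurable.
  have SA n : \big[setU/set0]_(i < n) A i `&` A n = set0.
    apply/seteqP; split => // x [+ Ax]; rewrite -bigcup_mkord => -[i /= i_n Aix].
    have E : i = n by apply: tA => //; exists x.
    by rewrite E ltnn in i_n.
  have nuS n : \sum_(0 <= i < n) nu (A i) = nu (\big[setU/set0]_(i < n) A i).
    rewrite big_mkord; elim: n => [|n IH]; first by rewrite !big_ord0 /nu ls.
    rewrite !big_ord_recr/= IH -EFinD -lU//.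
    exact/disj_set2P/SA.
  under eq_fun do rewrite nuS.
  apply: cvg_EFin; first by apply: filterE.
  apply/cvgrPdist_le => eps eps0.
  have [delta delta0 Nd] := Nac _ eps0.
  (* The probabilities of these remainders tend to 0; once below [delta], all [a m (B n)] are at
     most [eps], and so is their limit [l (B n)], which is the error of the partial sum. *)
  pose B n := (\bigcup_i A i) `\` (\big[setU/set0]_(i < n) A i).
  have mB n : measurable (B n) by exact: measurableD.
  have BE n : \bigcup_i A i = (\big[setU/set0]_(i < n) A i) `|` B n.
    by rewrite setDUK// => x; rewrite -bigcup_mkord => -[i _ Ax]; exists i.
  have PBE n : P (B n) = P (\bigcup_i A i) - \sum_(0 <= i < n) P (A i).
    have -> : \sum_(0 <= i < n) P (A i) = P (\big[setU/set0]_(i < n) A i).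
      by rewrite big_mkord measure_bigsetU.
    rewrite [in RHS](BE n) measureU//; last by rewrite setDIK.
    by rewrite addeAC subee ?add0e// fin_num_measure.
  have PB : P (B n) @[n --> \oo] --> 0.
    rewrite -(subee (fin_num_measure P _ mUA)).
    under eq_cvg do rewrite PBE.
    apply: cvgeB; [|exact: cvg_cst|exact: measure_semi_sigma_additive].
    by rewrite fin_num_adde_defr// fin_num_measure.
  have : \forall n \near \oo, P (B n) < delta%:E.
    have d0 : 0 < delta%:E by rewrite lte_fin.
    exact: PB _ (open_ereal_lt' d0).
  apply: filterS => n PBn.
  rewrite (BE n) lU//; last by apply/disj_set2P; rewrite setDIK.
  rewrite /= addrAC subrr add0r ger0_norm ?l0//.
  apply: limr_le; first exact: acvg.
  by apply: filterE => m; rewrite -lee_fin aE// Nd.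
have nufin A : measurable A -> nu A \is a fin_num by [].
have nus0 : nu set0 = 0 by rewrite /nu ls.
pose nuC : {charge set T -> \bar R} :=
  HB.pack nu (isCharge.Build _ _ _ nu nus0 nufin nusum).
have nuP : nuC `<< P.
  apply/null_content_dominatesP => A mA PA0 /=.
  congr EFin; apply: lc => //; apply: filterE => m /=.
  by rewrite /a null_set_integral//; exact: measurable_funTS.
pose xi := 'd nuC '/d P.
have ixi : P.-integrable setT xi by exact: Radon_Nikodym_integrable.
have xiE A : measurable A -> \int[P]_(x in A) xi x = (l A)%:E.
  by move=> mA; rewrite -Radon_Nikodym_integral.
have mB : measurable [set x | xi x < 0].
  rewrite -[[set _ | _]]setTI; apply: emeasurable_fun_infty_o => //.
  exact: measurable_int ixi.
exists xi; first by apply: integral_ge0_ae_ge0 => //; rewrite xiE ?lee_fin ?l0.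
move=> m; split => // A FA; have mA := FM _ _ FA.
rewrite xiE// -aE//; congr EFin; apply/esym/lc => //.
exists m => // k /= mk; apply: EFin_inj; rewrite !aE//.
by have [_ _ _ ->] := cN m k mk.
Qed.

End martingale_closure.

(** * Local regular processes belong to the cone *)

Section local_regular_decomposition.
Context (R : realType) (d : measure_display) (T : measurableType d).
Implicit Types (F : nat -> set (set T)) (P Q : probability T R).
Implicit Types (M : set (probability T R)) (X Y xi : T -> \bar R).
Implicit Types (f g v w h e : nat -> T -> \bar R).

(** Pointwise, [|f m|] is at most [c] plus its restriction to the set where it exceeds [c]. Uniform
    integrability makes the second integral at most [eps / 2], and [P A < eps / (2 c)] does so for
    the first. *)
Lemma uniformly_integrable_continuous P f :
  (forall m, measurable_fun setT (f m)) -> uniformly_integrable P f ->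
  forall eps : R, (0 < eps)%R -> exists2 delta : R, (0 < delta)%R &
    forall m A, measurable A -> P A < delta%:E ->
      \int[P]_(x in A) `|f m x| <= eps%:E.
Proof.
move=> mf ui eps eps0.
have e20 : 0 < (eps / 2)%:E by rewrite lte_fin divr_gt0.
have [c [c0 fc]] : exists c : R, (0 < c)%R /\
    ereal_sup [set \int[P]_(x in [set x | c%:E < `|f m x|]) `|f m x| | m in setT]
      < (eps / 2)%:E.
  have H : \forall c \near +oo%R, ereal_sup
      [set \int[P]_(x in [set x | c%:E < `|f m x|]) `|f m x| | m in setT]
      < (eps / 2)%:E by exact: ui _ (open_ereal_lt' e20).
  have [c [Hc c0]] := filter_ex (filterI H (nbhs_pinfty_gt (num_real (0 : R)))).
  by exists c.
exists (eps / 2 / c)%R; first by rewrite !divr_gt0.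
move=> m A mA PA.
pose B := [set x | c%:E < `|f m x|].
have mabs : measurable_fun setT (fun x => `|f m x|) by exact: measurableT_comp.
have mB : measurable B.
  rewrite -[B]setTI; exact: emeasurable_fun_o_infty.
have mrB : measurable_fun setT ((fun x => `|f m x|) \_ B).
  by apply/(measurable_restrictT _ mB); exact: measurable_funTS.
have rB0 x : 0 <= ((fun x => `|f m x|) \_ B) x by rewrite patchE; case: ifP.
apply: (@le_trans _ _
    (\int[P]_(x in A) (c%:E + ((fun x => `|f m x|) \_ B) x))).
  apply: ge0_le_integral => //.
  - exact: measurable_funTS.
  - by apply: emeasurable_funD => //; exact: measurable_funTS.
  move=> x _; rewrite patchE; case: ifPn => [_|].
    by rewrite leeDr// lee_fin ltW.
  by rewrite adde0 notin_setE /B/= => /negP; rewrite -leNgt.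
rewrite ge0_integralD//; last 2 first.
- by move=> x _; rewrite lee_fin ltW.
- exact: measurable_funTS.
rewrite integral_cst// (splitr eps) EFinD leeD//.
  apply: (@le_trans _ _ (c%:E * (eps / 2 / c)%:E)).
    by apply: lee_wpmul2l; [rewrite lee_fin ltW|exact: ltW].
  by rewrite -EFinM lee_fin mulrCA divff ?mulr1// gt_eqF.
apply: (@le_trans _ _ (\int[P]_x ((fun x => `|f m x|) \_ B) x)).
  exact: ge0_subset_integral.
rewrite -integral_mkcond; apply: le_trans (ltW fc).
by apply: ereal_sup_ubound; exists m.
Qed.

Lemma integrable_continuous P X : P.-integrable setT X ->
  forall eps : R, (0 < eps)%R -> exists2 delta : R, (0 < delta)%R &
    forall A, measurable A -> P A < delta%:E ->
      \int[P]_(x in A) X x <= eps%:E.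
Proof.
move=> iX eps eps0; have mX := measurable_int _ iX.
have XE := ae_fin_num iX.
have mfX : measurable_fun setT (EFin \o (fine \o X)).
  by apply/measurable_EFinP; exact: measurableT_comp.
have ifX : P.-integrable setT (EFin \o (fine \o X)).
  apply: ae_integrable iX => //.
  by apply: filterS XE => x Xx; rewrite /= fineK.
have [delta [delta0 Xd]] := integral_normr_continuous ifX eps0.
exists delta => // A mA PA.
have iA : P.-integrable A (EFin \o (fine \o X)) by exact: integrableS ifX.
rewrite (@ae_integral_eq _ _ _ P _ _ (EFin \o (fine \o X)))//; last first.
  by apply: filterS XE => x Xx; rewrite /= fineK.
apply: (@le_trans _ _ (\int[P]_(x in A) `|(fine \o X) x|%:E)).
  apply: ae_le_integral => //; first exact: integrable_norm.
  by apply: aeW => x; rewrite lee_fin ler_norm.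
have := Xd A mA PA; rewrite /Rintegral -lte_fin fineK; first exact: ltW.
by apply: integrable_fin_num => //; exact: integrable_norm.
Qed.

(* With [\int g_m] close to its limit at [m0], the inequality [g_m0 <= g_m] on
   the complement of [A] gives [\int_A g_m <= \int_A g_m0 + eps]. *)
Lemma nondecreasing_continuous P g (c : R) :
  (forall m, P.-integrable setT (g m)) ->
  (forall m, \forall x \ae P, g m x <= g m.+1 x) ->
  (forall m, \int[P]_x g m x <= c%:E) ->
  forall eps : R, (0 < eps)%R -> exists2 delta : R, (0 < delta)%R &
    forall m A, measurable A -> P A < delta%:E ->
      \int[P]_(x in A) g m x <= eps%:E.
Proof.
move=> ig gS gc eps eps0.
have e20 : (0 < eps / 2)%R by rewrite divr_gt0.
have gle k m : (k <= m)%N -> \forall x \ae P, g k x <= g m x.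
  elim: m => [|m IH]; first by rewrite leqn0 => /eqP ->; exact: aeW.
  rewrite leq_eqVlt ltnS => /predU1P[->|/IH km]; first exact: aeW.
  by apply: filterS2 km (gS m) => x; exact: le_trans.
pose a A m := fine (\int[P]_(x in A) g m x).
have aE A m : measurable A -> \int[P]_(x in A) g m x = (a A m)%:E.
  move=> mA; rewrite fineK//; apply: integrable_fin_num => //.
  exact: integrableS (ig m).
have ale A k m : measurable A -> (k <= m)%N -> (a A k <= a A m)%R.
  move=> mA km; rewrite -lee_fin -!aE//.
  by apply: ae_le_integral => //; exact: gle.
have aC A m : measurable A -> a setT m = (a A m + a (~` A) m)%R.
  move=> mA; apply: EFin_inj; rewrite EFinD -!aE//; last exact: measurableC.
  rewrite -[in LHS](setUv A) integral_setU//.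
  - exact: measurableC.
  - by apply: measurable_funTS; exact: measurable_int (ig m).
  - exact/disj_set2P/setICr.
(* The integrals over the whole space are nondecreasing and bounded by [c], so from some index on
   they stay within [eps / 2] of their limit, which bounds them all. *)
have [m0 am0] : exists m0, forall m, (a setT m <= a setT m0 + eps / 2)%R.
  have nda : nondecreasing_seq (a setT) by move=> k m; exact: ale.
  have ac : cvgn (a setT).
    apply: nondecreasing_is_cvgn => //; exists c => _ [m _ <-].
    by rewrite -lee_fin -aE.
  have /cvgrPdist_le/(_ _ e20)[m0 _ /(_ m0 (leqnn _))] := ac.
  move=> am0; exists m0 => m.
  have := nondecreasing_cvgn_le nda ac m.
  have := le_trans (ler_norm _) am0; lra.
have [delta delta0 gd] := integrable_continuous (ig m0) e20.
exists delta => // m A mA PA; have mCA := measurableC mA.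
have [mm0|/ltnW m0m] := leqP m m0.
  apply: (@le_trans _ _ (\int[P]_(x in A) g m0 x)).
    by rewrite !aE// lee_fin ale.
  by apply: le_trans (gd A mA PA) _; rewrite lee_fin; lra.
have := gd A mA PA; rewrite !aE// !lee_fin.
have := am0 m; have := ale _ _ _ mCA m0m; have := aC A m mA.
have := aC A m0 mA; lra.
Qed.

Lemma cst_condexp P (G : set (set T)) : is_condexp P G (cst 1) (cst 1).
Proof.
split => //; last exact: measurable_cst.
- exact: finite_measure_integrable_cst.
- exact: finite_measure_integrable_cst.
Qed.

Lemma cst1_setA0 M : setA0 M (cst 1).
Proof.
move=> P MP; split.
- exact: finite_measure_integrable_cst.
- exact: aeW.
- by rewrite integral_cst// mul1e; exact: probability_setT.
Qed.

(** The choice [xi = 1], whose conditional expectations are 1, puts integrable nonincreasing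
    processes in the cone; this serves for [- g]. *)
Lemma setF0_setV F M P0 h : M P0 -> setF0 F M h ->
  (forall m P, M P -> P.-integrable setT (h m)) -> setV F M h.
Proof.
move=> MP0 hF0 ih; exists (cst 1); first exact: cst1_setA0.
exists h, (fun=> cst 1); split => //.
- move=> m P MP; under eq_fun do rewrite mul1e.
  exact/integrable_abse/ih.
- by exists P0 => // m; exact: cst_condexp.
- by move=> m P MP; apply: aeW => x; rewrite mule1.
Qed.

(** Here the nonincreasing factor is the constant 1; this serves for the normalized martingale. *)
Lemma condexp_setV F M P0 xi e : M P0 -> setA0 M xi ->
  (forall m, is_condexp P0 (F m) xi (e m)) -> setV F M e.
Proof.
move=> MP0 Axi xie; exists xi => //.
exists (fun _ _ => 1), e; split => //.
- split.
  + by move=> m; exact: measurable_cst.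
  + by move=> m P MP; apply: aeW => x; rewrite abse1 ltry.
  + by move=> m P MP; exact: aeW.
- move=> m P MP; under eq_fun do rewrite abse1 mule1.
  by have [] := Axi P MP.
- by exists P0.
- by move=> m P MP; apply: aeW => x; rewrite mul1e.
Qed.

Lemma local_regular_setK F M P0 f : is_filtration F ->
  equivalent_measures M -> M P0 -> F1_densities F M P0 ->
  nonneg_process M f -> uniformly_integrable P0 f ->
  local_regular F M f -> setK F M f.
Proof.
move=> fF eM MP0 dM f0 ui [sf _ [g [[ag g0] gS g00 _ mart]]].
have [sF FS FM F0 _] := fF.
have [af _ _] := sf.
have [b0 fb] := supermartingale_bound fF MP0 sf.
have if_ m P : M P -> P.-integrable setT (f m) by move=> MP; have [] := fb P m MP.
pose N m x := f m x + g m x.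
have iN m P : M P -> P.-integrable setT (N m).
  by move=> MP; have [_ /(_ m m (leqnn _))[]] := mart P MP.
have N0 m P : M P -> \forall x \ae P, 0 <= N m x.
  by move=> MP; apply: filterS2 (f0 m P MP) (g0 m P MP) => x; exact: adde_ge0.
(* Cancelling needs [g m] finite, which holds where [N m] is finite because both summands are
   nonnegative. *)
have fE m P : M P -> \forall x \ae P, N m x - g m x = f m x.
  move=> MP; have gfin : \forall x \ae P, g m x \is a fin_num.
    apply: filterS3 (ae_fin_num (iN m P MP)) (f0 m P MP) (g0 m P MP) => x.
    by rewrite /N; case: (f m x) (g m x) => [a| |] [b| |].
  by apply: filterS gfin => x gx; rewrite /N addeK.
have ig m P : M P -> P.-integrable setT (g m).
  move=> MP; apply: (@ae_integrable _ _ _ P (N m \- f m)).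
  - exact: sub_measurable_measurable (FM m) (ag m).
  - apply: filterS (ae_fin_num (if_ m P MP)) => x fx.
    by rewrite /N/= addeAC subee// add0e.
  - by apply: integrableB => //; [exact: iN|exact: if_].
have [c Nc] : exists c, forall x, N 0%N x = c.
  apply: sub_measurable_trivial; rewrite -F0.
  by have [/(_ 0%N)] := mart P0 MP0.
have intN m P : M P -> \int[P]_x N m x = c.
  move=> MP; have [_ /(_ 0%N m (leq0n _))[_ _ _ <-]] := mart P MP; last first.
    by rewrite F0; right.
  under eq_integral do rewrite -/(N 0%N _) Nc.
  rewrite integral_cst//; transitivity (c * 1); last by rewrite mule1.
  by congr (_ * _); exact: probability_setT.
have cfin : c \is a fin_num.
  by rewrite -(intN 0%N P0)//; apply: integrable_fin_num => //; exact: iN.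
have c0 : 0 <= c.
  rewrite -(intN 0%N P0)//; apply: ae_integral_ge0 => //; last exact: N0.
  exact: measurable_int (iN _ _ MP0).
have Ng : setV F M (fun m x => - g m x).
  apply: setF0_setV MP0 _ _; last first.
    by move=> m P MP; apply: integrableN => //; exact: ig.
  split.
  - by move=> m; apply: measurableT_comp => //; exact: ag.
  - move=> m P MP; apply: filterS (ae_fin_num (ig m P MP)) => x.
    by rewrite abseN -fin_num_abs.
  - by move=> m P MP; apply: filterS (gS m P MP) => x; rewrite leeN2.
(* If [N_0 = 0] then [N] vanishes and [f = - g]. *)
have [cE|cN0] := eqVneq c 0.
  exists 1%N, (fun=> 1%R), (fun=> fun m x => - g m x); split=> // m P MP.
  have mN := measurable_int _ (iN m P MP).
  have : \int[P]_x `|N m x| = 0.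
    by rewrite integral_abse_ae_ge0//; [rewrite intN|exact: N0].
  move/(ae_eq_integral_abs P measurableT mN).
  apply: filterS2 (fE m P MP) => x fx /(_ I) Nx.
  by rewrite big_ord1 mul1e -fx Nx/= add0e.
have fc0 : (0 < fine c)%R.
  by rewrite fine_gt0// lt_neqAle eq_sym cN0 c0/= ltey_eq cfin.
have [xi xi0 xiN] : exists2 xi, (\forall x \ae P0, 0 <= xi x) &
    forall m, is_condexp P0 (F m) xi (N m).
  apply: martingale_closed => //; [exact: mart|by move=> m; exact: N0|].
  move=> eps eps0; have e20 : (0 < eps / 2)%R by rewrite divr_gt0.
  have mf m := measurable_int _ (if_ m _ MP0).
  have [d1 d10 fd] := uniformly_integrable_continuous mf ui e20.
  have [d2 d20 gd] : exists2 delta : R, (0 < delta)%R &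
      forall m A, measurable A -> P0 A < delta%:E ->
        \int[P0]_(x in A) g m x <= (eps / 2)%:E.
    have gc m : \int[P0]_x g m x <= (fine c)%:E.
      rewrite fineK// -(intN m P0)//; apply: ae_le_integral => //.
      - exact: ig.
      - exact: iN.
      - by apply: filterS (f0 m P0 MP0) => x fx; rewrite leeDr.
    exact: (nondecreasing_continuous (fun m => ig m P0 MP0)
      (fun m => gS m P0 MP0) gc e20).
  exists (Num.min d1 d2); first by rewrite lt_min d10.
  move=> m A mA PA.
  have iS X : P0.-integrable setT X -> P0.-integrable A X by exact: integrableS.
  rewrite integralD//; [|exact/iS/if_|exact/iS/ig].
  rewrite (splitr eps) EFinD leeD//.
    apply: (@le_trans _ _ (\int[P0]_(x in A) `|f m x|)).
      apply: ae_le_integral => //; [exact: if_|exact/integrable_abse/if_|].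
      by apply: aeW => x; exact: lee_abs.
    by apply: fd => //; apply: lt_le_trans PA _; rewrite lee_fin ge_min lexx.
  by apply: gd => //; apply: lt_le_trans PA _; rewrite lee_fin ge_min lexx orbT.
pose r := ((fine c)^-1)%R.
have rc : r%:E * c = 1.
  by rewrite -[c]fineK// -EFinM mulVf// gt_eqF.
have Axi : setA0 M (fun x => r%:E * xi x).
  move=> P MP; have [PP0 _] := eM _ _ MP MP0.
  have [ixi _ _ _] := xiN 0%N; have mxi := measurable_int _ ixi.
  have xi0P : \forall x \ae P, 0 <= xi x by exact: ae_dominated xi0.
  (* [xi] closes [N] under [P0] only. Time 1 is the first at which the change of measure applies; on
     the whole space it equates the [P]-integrals of [xi] and [N 1]. *)
  have xi1 : \int[P]_x xi x = c.
    rewrite -(condexp_change fF eM dM MP MP0 (leqnn _) (xiN 1%N))//.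
      exact: intN.
    by rewrite -measurable_g_sigma_algebraE.
  have iPxi : P.-integrable setT xi.
    apply/integrableP; split => //.
    by rewrite integral_abse_ae_ge0// xi1 ltey_eq cfin.
  split; first exact: integrableZl.
  - by apply: filterS xi0P => x xx; rewrite mule_ge0// lee_fin invr_ge0 ltW.
  - by rewrite integralZl// xi1.
have rN : setV F M (fun m x => r%:E * N m x).
  apply: (condexp_setV MP0 Axi) => m; have [ixi iNm mNm xiNE] := xiN m.
  split; try exact: integrableZl.
    exact: measurable_funeM.
  move=> A FA; have mA := FM _ _ FA.
  have iS X : P0.-integrable setT X -> P0.-integrable A X by exact: integrableS.
  by rewrite !integralZl ?iS// xiNE.
(* The decomposition is [f = c (N / c) + 1 (- g)]. *)
exists 2%N, (fun i => if i == ord0 then fine c else 1%R),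
  (fun i => if i == ord0 then fun m x => r%:E * N m x else fun m x => - g m x).
split => //.
- by move=> i; case: ifP => // _; exact: ltW.
- by move=> i; case: ifP.
move=> m P MP; apply: filterS (fE m P MP) => x <-.
rewrite !big_ord_recl big_ord0/= adde0 mul1e muleA -EFinM divff ?mul1e//.
by rewrite gt_eqF.
Qed.

End local_regular_decomposition.

Theorem theorem5 (R : realType) (d : measure_display) (T : measurableType d)
    (F : nat -> set (set T)) (M : set (probability T R)) (P0 : probability T R)
    (f : nat -> T -> \bar R) :
  is_filtration F ->
  convex_measures M -> equivalent_measures M ->
  M P0 -> F1_densities F M P0 ->
  supermartingale F M f -> nonneg_process M f ->
  (forall P, M P -> uniformly_integrable P f) ->
  local_regular F M f <-> setK F M f.
Proof.
move=> fF _ eM MP0 dM sf f0 ui; split.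
  exact: local_regular_setK fF eM MP0 dM f0 (ui _ MP0).
exact: setK_local_regular fF eM MP0 dM sf f0.
Qed.
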